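(* For $n\ge 1$ let $L(n,2)$ be the double loopy star with $n$ outer vertices. In the Strings-and-Coins game under optimal play: on $L(1,2)$ the game is a tie; on $L(2,2)$ Player 2 wins by exactly one point; and for $n\ge 3$, Player 2 wins on $L(n,2)$ by exactly two points when $n$ is odd and by exactly three points when $n$ is even. In particular Player 2 wins on $L(n,2)$ for every $n\ge 2$.
   Context: Strings-and-Coins game: played on a finite multigraph (loops and parallel edges allowed) in which every vertex initially has at least one incident edge. Two players, Player 1 moving first, alternately remove one edge (a loop counts as one edge). Whenever a removal leaves one or more vertices with no incident edges, the mover earns one point for each such vertex and must move again, provided edges remain. The game ends when no edges remain; a player wins if they have more points, and it is a tie if scores are equal. Optimal play means each player maximizes (own final score) minus (opponent's final score). ''Player X wins by $k$ points'' means that under optimal play the final score of X exceeds the opponent's by exactly $k$. The double loopy star $L(n,2)$ has a central vertex $c$ (with no loop) and $n$ outer vertices $v_1,\dots,v_n$; for each $i$ there is one edge $cv_i$ and two loops at $v_i$, and there are no other edges. *)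

(* Defs.v *)
From HB Require Import structures.
From mathcomp Require Import all_boot all_order all_algebra.

Set Implicit Arguments.
Unset Strict Implicit.
Unset Printing Implicit Defensive.

Import Order.TTheory GRing.Theory Num.Theory.

(* [ends e] lists the endpoints of [e]; their order is irrelevant, and a loop
   has its two endpoints equal.  Parallel edges are distinct elements of
   [edge] with the same endpoints. *)
Record multigraph := Multigraph {
  vertex : finType;
  edge : finType;
  ends : edge -> vertex * vertex
}.

Definition incident (G : multigraph) (e : edge G) (v : vertex G) : bool :=
  (v == (ends e).1) || (v == (ends e).2).

(* The game is meant for multigraphs satisfying this condition. *)
Definition every_vertex_covered (G : multigraph) : Prop :=
  forall v : vertex G, exists e : edge G, incident e v.

Definition isolated (G : multigraph) (S : {set edge G}) : {set vertex G} :=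
  [set v | [forall e in S, ~~ incident e v]].

Inductive player := Player1 | Player2.

Definition opponent (X : player) : player :=
  match X with Player1 => Player2 | Player2 => Player1 end.

Definition add_points (X : player) (k : nat) (s : player -> nat) :
    player -> nat :=
  fun Y => match X, Y with
           | Player1, Player1 | Player2, Player2 => s Y + k
           | _, _ => s Y
           end.

Record position (G : multigraph) := Position {
  remaining : {set edge G};
  to_move : player;
  score : player -> nat
}.

Definition start (G : multigraph) : position G :=
  Position [set: edge G] Player1 (fun _ => 0).

Definition gain (G : multigraph) (p : position G) (e : edge G) : nat :=
  #|isolated (remaining p :\ e) :\: isolated (remaining p)|.

Definition remove (G : multigraph) (p : position G) (e : edge G) :
    position G :=
  Position (remaining p :\ e)
    (if 0 < gain p e then to_move p else opponent (to_move p))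
    (add_points (to_move p) (gain p e) (score p)).

Definition margin (X : player) (s : player -> nat) : int :=
  ((s X)%:Z - (s (opponent X))%:Z)%R.

(* Backward induction: the player to move removes a remaining edge that
   maximizes that player's own final margin, given optimal play afterwards.
   Several edges may be optimal, but since one player's margin is the opposite
   of the other's, the resulting final margin does not depend on which is
   chosen.  [n] bounds the number of remaining edges. *)
Fixpoint optimal_scores_rec (G : multigraph) (n : nat) (p : position G) :
    player -> nat :=
  if n is n'.+1 then
    if [pick e in remaining p] is Some e0 then
      optimal_scores_rec n' (remove p
        [arg max_(e > e0 in remaining p)
           margin (to_move p) (optimal_scores_rec n' (remove p e))]%O)
    else score p
  else score p.

Definition optimal_scores (G : multigraph) : player -> nat :=
  optimal_scores_rec #|edge G| (start G).

Definition wins (X : player) (G : multigraph) : Prop :=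
  optimal_scores G (opponent X) < optimal_scores G X.

Definition wins_by (X : player) (k : nat) (G : multigraph) : Prop :=
  optimal_scores G X = optimal_scores G (opponent X) + k.

Definition tie (G : multigraph) : Prop :=
  optimal_scores G Player1 = optimal_scores G Player2.

(* [L n m]: the central vertex is [None] and the outer vertices are [Some i];
   the edge [inl i] joins the centre to [Some i], and the edges [inr (i, j)],
   for [j : 'I_m], are the loops at [Some i]. *)
Definition L (n m : nat) : multigraph :=
  @Multigraph (option 'I_n) ('I_n + 'I_n * 'I_m)%type
    (fun e => match e with
              | inl i => (None, Some i)
              | inr (i, _) => (Some i, Some i)
              end).

Lemma L_covered (n m : nat) : 0 < n -> every_vertex_covered (L n m).
Proof.
move=> n_gt0 [i|]; first by exists (inl i); rewrite /incident /= ?eqxx ?orbT.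
by exists (inl (Ordinal n_gt0)); rewrite /incident /= ?eqxx.
Qed.

(* Main.v *)
(** The value of a position (the mover's margin under optimal play) depends only
on how many outer vertices there are of each of the five kinds: string still
present with 2, 1 or 0 loops, or string removed with 2 or 1 loops.  On these
five counts it has a closed form, which satisfies the minimax recurrence: no
move does better, and in a nonterminal position some move attains it. *)

Require Import Defs.
From HB Require Import structures.
From mathcomp Require Import all_boot all_order all_algebra.
From mathcomp Require Import zify.

Set Implicit Arguments.
Unset Strict Implicit.
Unset Printing Implicit Defensive.

Import Order.TTheory GRing.Theory Num.Theory.

(** * The minimax recurrence for an arbitrary multigraph *)

Definition captures (G : multigraph) (S : {set edge G}) (e : edge G) : nat :=
  #|isolated (S :\ e) :\: isolated S|.

(* The mover's margin from a move capturing [k] coins, [z] being the margin, for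
   whoever then moves, of the position reached. *)
Definition signed_value (k : nat) (z : int) : int :=
  if 0 < k then (k%:Z + z)%R else (- z)%R.

Lemma margin_opponent X s : margin (opponent X) s = (- margin X s)%R.
Proof. by case: X; rewrite /margin /= opprB. Qed.

Lemma margin_add_points X k s :
  margin X (add_points X k s) = (margin X s + k%:Z)%R.
Proof. by case: X; rewrite /margin /=; lia. Qed.

(** A solution of the minimax recurrence is the value function, by induction on the number of
    remaining edges. Points already scored only shift the margin, so [f] depends on the edge set
    alone. *)
Lemma optimal_margin (G : multigraph) (f : {set edge G} -> int) :
    f set0 = 0%R ->
    (forall (S : {set edge G}) e, e \in S ->
       (signed_value (captures S e) (f (S :\ e)) <= f S)%R) ->
    (forall S : {set edge G}, S != set0 ->
       exists2 e, e \in S & signed_value (captures S e) (f (S :\ e)) = f S) ->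
  forall k (p : position G), #|remaining p| <= k ->
    margin (to_move p) (optimal_scores_rec k p)
      = (margin (to_move p) (score p) + f (remaining p))%R.
Proof.
move=> f0 f_ub f_attained; elim=> [|k IHk] p.
  by rewrite leqn0 cards_eq0 => /eqP /= ->; rewrite f0 addr0.
move=> le_p_k /=; case: pickP => [e0 Se0 | S0]; last first.
  suff -> : remaining p = set0 by rewrite f0 addr0.
  by apply/setP=> e; rewrite inE; apply: S0.
have value_remove e : e \in remaining p ->
    margin (to_move p) (optimal_scores_rec k (remove p e))
    = (margin (to_move p) (score p)
       + signed_value (captures (remaining p) e) (f (remaining p :\ e)))%R.
  move=> Se; have le_k : #|remaining p :\ e| <= k.
    by move: le_p_k; rewrite (cardsD1 e) Se.
  have := IHk (remove p e) le_k.
  rewrite /= -[gain p e]/(captures (remaining p) e) /signed_value.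
  case: posnP => [-> | _]; rewrite ?margin_opponent margin_add_points; lia.
(* The chosen edge yields at most [f] by [f_ub], and at least [f] since it does as well as the edge
   that attains [f]. *)
case: arg_maxP => // e Se e_max.
apply/eqP; rewrite eq_le value_remove // lerD2l f_ub //=.
have [|e1 Se1 <-] := f_attained (remaining p).
  by apply/set0Pn; exists e.
by rewrite -value_remove //; have := e_max _ Se1; rewrite value_remove.
Qed.

(** * The game on censuses and its closed form *)

(* [Census a b c d e] counts the outer vertices by what is left at them:
   [a], [b], [c] have their string and 2, 1, 0 loops, while [d], [e] have lost
   their string and have 2, 1 loops.  Vertices with nothing left are dropped. *)
Variant census := Census of nat & nat & nat & nat & nat.

Definition nat5_of_census x :=
  let: Census a b c d e := x in (a, b, c, d, e).
Definition census_of_nat5 x :=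
  let: (a, b, c, d, e) := x in Census a b c d e.
Lemma nat5_of_censusK : cancel nat5_of_census census_of_nat5.
Proof. by case. Qed.
HB.instance Definition _ := Equality.copy census (can_type nat5_of_censusK).

Definition last_string (x : census) : bool :=
  let: Census a b c _ _ := x in a + b + c == 1.

(* In both kinds of move, [l] is the number of loops at the vertex concerned;
   the values for [l > 2], and for [l = 0] in [loop_move], are junk. *)
Definition string_move (l : nat) (x : census) : nat * census :=
  let: Census a b c d e := x in
  match l with
  | 0 => ((last_string x).+1, Census a b c.-1 d e)
  | 1 => (last_string x : nat, Census a b.-1 c d e.+1)
  | _ => (last_string x : nat, Census a.-1 b c d.+1 e)
  end.

Definition loop_move (s : bool) (l : nat) (x : census) : nat * census :=
  let: Census a b c d e := x in
  match s, l with
  | true, 1 => (0, Census a b.-1 c.+1 d e)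
  | true, _ => (0, Census a.-1 b.+1 c d e)
  | false, 1 => (1, Census a b c d e.-1)
  | false, _ => (0, Census a b c d.-1 e.+1)
  end.

Definition moves (x : census) : seq (nat * census) :=
  let: Census a b c d e := x in
  [seq y.2 | y <-
    [:: (0 < a, string_move 2 x); (0 < b, string_move 1 x);
        (0 < c, string_move 0 x);
        (0 < a, loop_move true 2 x); (0 < b, loop_move true 1 x);
        (0 < d, loop_move false 2 x); (0 < e, loop_move false 1 x)] & y.1].

(* Found by tabulating small positions: each of the [c + e] capturable vertices
   is worth one point to the mover, and away from small [a], [b] the remainder
   depends only on parities. *)
Definition best_margin (x : census) : int :=
  let: Census a b c d e := x in
  ((c + e)%N%:Z +
   match a, b, odd d with
   | 0, 0, _ => (0 < c)%N%:Z - (odd d)%:Z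
   | 1, 0, _ => (odd d)%:Z
   | 2, 0, false => -1
   | 0, 1, true => 1
   | _, _, _ => if odd b (+) odd d then 2 + (odd a)%:Z else (odd a)%:Z - 3
   end)%R.

Definition move_value (m : nat * census) : int :=
  signed_value m.1 (best_margin m.2).

Lemma best_margin_ub x :
  all (fun m => move_value m <= best_margin x)%R (moves x).
Proof.
case: x => a b c d e.
(* [best_margin] singles out [a <= 2], [b <= 1] and [c = 0], and a move lowers a count by at most
   one, so one further value of each is split off. Beyond these only parities matter. *)
case: a => [|[|[|[|a]]]]; case: b => [|[|[|b]]]; case: c => [|[|c]];
  case: d => [|d]; case: e => [|e] //;
  rewrite /moves /move_value /signed_value /= ?addSn ?addnS /= ?eqSS ?negbK;
  try case: (odd d); try case: (odd b); try case: (odd a);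
  rewrite /=; lia.
Qed.

Lemma best_margin_attained x : ~~ nilp (moves x) ->
  has (fun m => move_value m == best_margin x) (moves x).
Proof.
case: x => a b c d e.
case: a => [|[|[|[|a]]]]; case: b => [|[|[|b]]]; case: c => [|[|c]];
  case: d => [|d]; case: e => [|e] //=;
  rewrite /moves /move_value /signed_value /= ?addSn ?addnS /= ?eqSS ?negbK;
  try case: (odd d); try case: (odd b); try case: (odd a);
  rewrite /= => _; lia.
Qed.

(** * From edge sets of the star to censuses *)

Section Star.

Variable n : nat.
Implicit Types (S : {set edge (L n 2)}) (e : edge (L n 2)) (i : 'I_n).

Definition string i : edge (L n 2) := inl i.
Definition loop i j : edge (L n 2) := inr (i, j).

Definition branch S i : bool * nat :=
  (string i \in S, \sum_(j < 2) (loop i j \in S)).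

Arguments branch : simpl never.

Definition tally (P : pred (bool * nat)) S : nat :=
  \sum_(i < n) P (branch S i).

Definition census_of S : census :=
  let count t := tally (pred1 t) S in
  Census (count (true, 2)) (count (true, 1)) (count (true, 0))
         (count (false, 2)) (count (false, 1)).

Definition branch_of e : 'I_n :=
  match e with inl i => i | inr (i, _) => i end.

Lemma branch_le2 S i : (branch S i).2 <= 2.
Proof.
by rewrite /= !big_ord_recr big_ord0 /=; do 2 case: (_ \in _).
Qed.

Lemma branch_string S i :
  branch (S :\ string i) i = (false, (branch S i).2).
Proof.
rewrite /branch setD11; congr (_, _); apply: eq_bigr => j _.
by rewrite in_setD1.
Qed.

Lemma branch_loop S i j : loop i j \in S ->
  branch (S :\ loop i j) i = ((branch S i).1, (branch S i).2.-1).
Proof.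
move=> Sij; rewrite /branch in_setD1 /=; congr (_, _).
rewrite (bigD1 j) //= setD11 [in RHS](bigD1 j) //= Sij.
apply: eq_bigr => k; rewrite in_setD1; case: (loop i k =P _) => // -[->].
by rewrite eqxx.
Qed.

Lemma branch_other S e i : i != branch_of e -> branch (S :\ e) i = branch S i.
Proof.
move=> nie; rewrite /branch in_setD1; congr (_ , _); last first.
  apply: eq_bigr => j _; rewrite in_setD1.
  by case: (_ =P e) nie => // <- /=; rewrite eqxx.
by case: (_ =P e) nie => // <- /=; rewrite eqxx.
Qed.

(** Only the summand at the vertex [branch_of e] changes. The additive form avoids truncated
    subtraction. *)
Lemma tally_remove P S e :
  tally P (S :\ e) + P (branch S (branch_of e))
    = tally P S + P (branch (S :\ e) (branch_of e)).
Proof.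
rewrite /tally (bigD1 (branch_of e)) // [in RHS](bigD1 (branch_of e)) //=.
under eq_bigr => i nie do rewrite branch_other //.
lia.
Qed.

(** This makes isolation of the centre, which means no string is left, readable from the census. *)
Lemma tally_strings S :
  tally fst S = tally (pred1 (true, 2)) S + tally (pred1 (true, 1)) S
                + tally (pred1 (true, 0)) S.
Proof.
rewrite /tally -!big_split; apply: eq_bigr => i _.
by have := branch_le2 S i; case: (branch S i) => [[] [|[|[|l]]]].
Qed.

Lemma outer_isolated S i :
  (Some i \in isolated S) = (branch S i == (false, 0)).
Proof.
rewrite inE; apply/forall_inP/eqP => [iso_i | [nSi /eqP]].
  congr (_, _).
    by apply/negP => /iso_i; rewrite /incident /= eqxx.
  apply: big1 => j _; apply/eqP; rewrite eqb0; apply/negP => /iso_i.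
  by rewrite /incident /= eqxx.
rewrite sum_nat_eq0 => /forall_inP no_loop [k | [k j]] Se;
  apply/negP; rewrite /incident /= ?orbb => /eqP [ik].
  by rewrite /string ik Se in nSi.
by have := no_loop j isT; rewrite /loop ik Se.
Qed.

Lemma center_isolated S :
  ((None : vertex (L n 2)) \in isolated S) = (tally fst S == 0).
Proof.
rewrite inE sum_nat_eq0.
apply/forall_inP/forall_inP => [iso i _ | no_string [i | [i j]] Se //].
  by rewrite eqb0; apply/negP => /iso.
by have := no_string i isT; rewrite /= /string Se.
Qed.

Lemma card_isolated S :
  #|isolated S| = (tally fst S == 0) + tally (pred1 (false, 0)) S.
Proof.
rewrite -sum1_card big_mkcond /= (bigD1 None) //= center_isolated.
congr (_ + _).
rewrite (reindex_omap Some id) /=; last by case.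
apply: eq_big => [i | i _]; first by rewrite eqxx.
by rewrite outer_isolated /=; case: eqP.
Qed.

(** Isolated vertices stay isolated when an edge goes, so the captured ones are exactly the
    increase. *)
Lemma captures_isolated S e :
  captures S e + #|isolated S| = #|isolated (S :\ e)|.
Proof.
rewrite -(cardsID (isolated S) (isolated (S :\ e))) addnC (setIidPr _) //.
apply/subsetP => v; rewrite !inE => /forall_inP iso_v.
by apply/forall_inP => f /setD1P [_ /iso_v].
Qed.

Lemma captures_tally S e :
  captures S e + ((tally fst S == 0) + tally (pred1 (false, 0)) S)
  = (tally fst (S :\ e) == 0) + tally (pred1 (false, 0)) (S :\ e).
Proof. by rewrite -!card_isolated captures_isolated. Qed.

Lemma remove_string S i : string i \in S ->
  (captures S (string i), census_of (S :\ string i))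
    = string_move (branch S i).2 (census_of S).
Proof.
move=> Si; have := captures_tally S (string i).
have tallyE P := tally_remove P S (string i).
have br_i : branch S i = (true, (branch S i).2) by rewrite -Si.
have := branch_le2 S i; rewrite !tally_strings /census_of /last_string.
move: tallyE; rewrite [branch_of _]/= branch_string br_i.
case: (branch S i).2 => [|[|[|l]]] // tallyE _;
  (* The state [(false, 0)] is absent from the census, but its tally is needed for the captures. *)
  move: (tallyE (pred1 (true, 2))) (tallyE (pred1 (true, 1)))
        (tallyE (pred1 (true, 0))) (tallyE (pred1 (false, 2)))
        (tallyE (pred1 (false, 1))) (tallyE (pred1 (false, 0)));
  rewrite /= ?addn0 => *; congr (_, Census _ _ _ _ _); lia.
Qed.

Lemma loop_branch S i j : loop i j \in S -> 0 < (branch S i).2.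
Proof. by move=> Sij; rewrite /branch /= (bigD1 j) //= Sij. Qed.

Lemma remove_loop S i j : loop i j \in S ->
  (captures S (loop i j), census_of (S :\ loop i j))
    = loop_move (branch S i).1 (branch S i).2 (census_of S).
Proof.
move=> Sij; have := captures_tally S (loop i j).
have tallyE P := tally_remove P S (loop i j).
have := loop_branch Sij; have := branch_le2 S i.
rewrite !tally_strings /census_of.
move: tallyE; rewrite [branch_of _]/= branch_loop //.
case: (branch S i) => [[] [|[|[|l]]]] // tallyE _ _;
  move: (tallyE (pred1 (true, 2))) (tallyE (pred1 (true, 1)))
        (tallyE (pred1 (true, 0))) (tallyE (pred1 (false, 2)))
        (tallyE (pred1 (false, 1))) (tallyE (pred1 (false, 0)));
  rewrite /= ?addn0 => *; congr (_, Census _ _ _ _ _); lia.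
Qed.

Lemma tally_gt0 t S i : branch S i = t -> 0 < tally (pred1 t) S.
Proof. by move=> <-; rewrite /tally (bigD1 i) //= eqxx. Qed.

Lemma tally_gt0_ex t S : 0 < tally (pred1 t) S -> exists i, branch S i = t.
Proof.
rewrite lt0n sum_nat_eq0 negb_forall => /existsP [i].
by rewrite /= eqb0 negbK => /eqP; exists i.
Qed.

Definition census_move S e : nat * census :=
  (captures S e, census_of (S :\ e)).

(** With its converse [census_moveP], this makes the edge game and the census game have the same
    options: this direction carries over the upper bound, the converse its attainment. *)
Lemma census_move_in S e : e \in S -> census_move S e \in moves (census_of S).
Proof.
move=> Se; apply/mapP; exists (true, census_move S e) => //.
rewrite mem_filter !inE /= /census_move.
case: e Se => [i | [i j]] Se.
  rewrite remove_string //; have := branch_le2 S i.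
  have := tally_gt0 (erefl (branch S i)).
  have -> : branch S i = (true, (branch S i).2) by rewrite -Se.
  by case: (branch S i).2 => [|[|[|l]]] //= ->; rewrite eqxx ?orbT.
rewrite remove_loop //; have := branch_le2 S i; have := loop_branch Se.
have := tally_gt0 (erefl (branch S i)).
by case: (branch S i) => [[] [|[|[|l]]]] //= ->; rewrite eqxx ?orbT.
Qed.

Lemma census_moveP S m :
  m \in moves (census_of S) -> exists2 e, e \in S & census_move S e = m.
Proof.
have stringP l : 0 < tally (pred1 (true, l)) S ->
    exists2 e, e \in S & census_move S e = string_move l (census_of S).
  case/tally_gt0_ex => i br_i; have Si : string i \in S by case: br_i.
  by exists (string i); rewrite // /census_move remove_string // br_i.
(* The index [l.+1] ensures that there is a loop to remove. *)
have loopP s l : 0 < tally (pred1 (s, l.+1)) S ->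
    exists2 e, e \in S & census_move S e = loop_move s l.+1 (census_of S).
  case/tally_gt0_ex => i br_i.
  have [j Sij] : exists j, loop i j \in S.
    have : \sum_(j < 2) (loop i j \in S) != 0 by case: br_i => _ ->.
    rewrite sum_nat_eq0 negb_forall => /existsP [j].
    by rewrite /= eqb0 negbK => Sij; exists j.
  by exists (loop i j); rewrite // /census_move remove_loop // br_i.
case/mapP=> -[b m']; rewrite mem_filter => /andP [/= b_true] + ->.
rewrite !inE b_true => /or4P
  [/eqP | /eqP | /eqP | /or4P [] /eqP] [/esym count_gt0 ->].
- exact: stringP count_gt0.
- exact: stringP count_gt0.
- exact: stringP count_gt0.
- exact: loopP count_gt0.
- exact: loopP count_gt0.
- exact: loopP count_gt0.
- exact: loopP count_gt0.
Qed.

Lemma optimal_margin_star :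
  margin Player1 (optimal_scores (L n 2)) = best_margin (Census n 0 0 0 0).
Proof.
pose f S := best_margin (census_of S).
have f0 : f set0 = 0%R.
  have branch0 i : branch set0 i = (false, 0).
    by rewrite /branch in_set0; congr (_, _); apply: big1 => j _; rewrite in_set0.
  have tally0 t : t != (false, 0) -> tally (pred1 t) set0 = 0.
    by move=> nt; apply: big1 => i _; rewrite branch0 /= eq_sym (negbTE nt).
  by rewrite /f /census_of !tally0.
have f_ub S e : e \in S ->
    (signed_value (captures S e) (f (S :\ e)) <= f S)%R.
  by move=> /census_move_in; apply: allP (best_margin_ub _) _.
have f_attained S : S != set0 ->
    exists2 e, e \in S & signed_value (captures S e) (f (S :\ e)) = f S.
  case/set0Pn => e0 /census_move_in Se0.
  have : ~~ nilp (moves (census_of S)) by case: (moves _) Se0.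
  move=> /best_margin_attained /hasP [m /census_moveP [e Se <-] /eqP].
  by exists e.
have := optimal_margin f0 f_ub f_attained (p := start _) (leqnn _).
rewrite cardsT => ->; rewrite /f /= /margin subrr add0r.
have branchT i : branch setT i = (true, 2).
  rewrite /branch inE; congr (_, _).
  by under eq_bigr do rewrite inE; rewrite sum1_card card_ord.
have tallyT t : tally (pred1 t) setT = n * (t == (true, 2)).
  rewrite /tally; under eq_bigr do rewrite branchT /= eq_sym.
  by rewrite sum_nat_const card_ord.
by rewrite /f /census_of !tallyT muln1 !muln0.
Qed.

End Star.

Theorem theorem4 :
  tie (L 1 2) /\
  wins_by Player2 1 (L 2 2) /\
  (forall n : nat, 3 <= n -> odd n -> wins_by Player2 2 (L n 2)) /\
  (forall n : nat, 3 <= n -> ~~ odd n -> wins_by Player2 3 (L n 2)) /\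
  (forall n : nat, 2 <= n -> wins Player2 (L n 2)).
Proof.
(* From three outer vertices on, the initial census falls in the default case of [best_margin], with
   [b] and [d] both even; one and two vertices are exceptional entries. *)
have margin_ge3 n : 3 <= n ->
    margin Player1 (optimal_scores (L n 2)) = ((odd n)%:Z - 3)%R.
  by case: n => [|[|[|n]]] // _; rewrite optimal_margin_star /= add0r.
have margin1 := optimal_margin_star 1; have margin2 := optimal_margin_star 2.
rewrite /tie /wins /wins_by /=; rewrite /margin /= in margin_ge3 margin1 margin2.
split; first by lia.
split; first by lia.
split=> [n n_ge3 n_odd|]; first by have := margin_ge3 n n_ge3; lia.
split=> [n n_ge3 n_even|n n_ge2]; first by have := margin_ge3 n n_ge3; lia.
have [n_ge3 | n_lt3] := leqP 3 n; first by have := margin_ge3 n n_ge3; lia.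
have -> : n = 2 by lia.
lia.
Qed.
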